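(* Uniformly for integers $2\le k\le n$, $\mathbb{E}[X_{\ge k}(n)]=O\big(n^{3/2}/(k-2)!\big)$. Consequently, for every $\varepsilon>0$, $$\mathbb{P}\Big(\mathcal{R}_n\le (1.5+\varepsilon)\frac{\log n}{\log\log n}\Big)=1-O\big(n^{-\varepsilon+o(1)}\big).$$
   Context: A plane increasing tree on $[n]$ is a rooted tree with vertex set $[n]$ in which every non-root vertex has a larger label than its parent (the root is $1$) and the children of each vertex are linearly ordered; there are $(2n-3)!!$ such trees. Let $T_n$ be chosen uniformly at random among them. The rank of a vertex $v$ is the number of edges of a shortest path from $v$ down to a leaf descendant of $v$. $X_{\ge k}(n)$ denotes the number of vertices of rank at least $k$ in $T_n$, and $\mathcal{R}_n$ the largest rank of a vertex of $T_n$. $\log$ is the natural logarithm. *)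

(* Defs.v *)
From HB Require Import structures.
From mathcomp Require Import all_boot all_order all_algebra.
From mathcomp Require Import all_classical all_reals all_analysis.

Set Implicit Arguments.
Unset Strict Implicit.
Unset Printing Implicit Defensive.

Import Order.TTheory GRing.Theory Num.Theory.

Local Open Scope nat_scope.

(* The vertex with label [l] of [1..n] is the ordinal [l - 1 : 'I_n], so the
   root is the ordinal of value 0.  A tree is given by [c], where [c v] is the
   list of the children of [v] from left to right.  Labels increase along the
   edges, the root is nobody's child, and every other vertex occurs exactly once
   among all the lists of children (i.e. it has a unique parent); since labels
   increase, following parents always ends at the root. *)
Definition is_plane_increasing n (c : {ffun 'I_n -> n.-bseq 'I_n}) : bool :=
  [forall v : 'I_n, all (fun w : 'I_n => v < w) (c v)] &&
  [forall w : 'I_n, \sum_(v < n) count_mem w (c v) == (val w != 0)].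

Definition pitree n := {c : {ffun 'I_n -> n.-bseq 'I_n} | is_plane_increasing c}.

Definition children n (t : pitree n) (v : 'I_n) : seq 'I_n := val t v.

Definition child n (t : pitree n) : rel 'I_n := fun v w => w \in children t v.

Definition leaf n (t : pitree n) (v : 'I_n) : bool := nilp (children t v).

(* [v :: p] is a downward path with [size p] edges ending at a leaf.  Such paths
   have fewer than [n] edges, and there is one from every vertex, so the default
   value [n] of the minimum is never attained. *)
Definition rank n (t : pitree n) (v : 'I_n) : nat :=
  \big[minn/n]_(p : n.-bseq 'I_n | path (child t) v p && leaf t (last v p))
    size p.

Definition X_ge k n (t : pitree n) : nat := #|[pred v | k <= rank t v]|.

Definition max_rank n (t : pitree n) : nat := \max_(v < n) rank t v.

Local Open Scope ring_scope.

Definition unif_expect (R : realType) (T : finType) (X : T -> R) : R :=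
  (\sum_(t : T) X t) / #|T|%:R.

Definition unif_prob (R : realType) (T : finType) (A : pred T) : R :=
  #|A|%:R / #|T|%:R.

(* Main.v *)
(** If [v] has rank at least [k], then following first children from [v] gives
    a chain [v < v_1 < ... < v_k].  Detaching the [v_i] from each other and
    making them the first [k] children of [v], in any of the [k!] orders, yields
    a new plane increasing tree from which the chain and the order can be read
    off.  Hence [v] has rank at least [k] with probability at most [1 / k!], so
    that [E[X_{>=k}] <= n / k!], which beats the required bound.  By Markov's
    inequality the largest rank exceeds [x] with probability at most [n / k!]
    for [k = floor x + 1].  If [x = a ln n / ln (ln n)], then [k! >= (x / e)^x]
    exceeds [n^c] for every [c < a]; taking [a = 3/2 + eps] and [c = 1 + eps]
    shows that the [o(1)] in the exponent can be taken to be 0. *)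

Require Import Defs.
From HB Require Import structures.
From mathcomp Require Import all_boot all_order all_algebra.
From mathcomp Require Import all_classical all_reals all_analysis.
From mathcomp Require Import ring lra.

Set Implicit Arguments.
Unset Strict Implicit.
Unset Printing Implicit Defensive.

Import Order.TTheory GRing.Theory Num.Theory.
Import numFieldNormedType.Exports.

Local Open Scope classical_set_scope.
Local Open Scope ring_scope.

Section Spine.
Local Open Scope nat_scope.
Variables (disp : Order.disp_t) (T : finOrderType disp).
Implicit Types (d : T -> seq T) (u v w : T) (p : seq T) (k : nat).

Definition increasing d : Prop := forall u w, w \in d u -> (u < w)%O.

Definition indegree d w : nat := \sum_(u : T) count_mem w (d u).

Definition first_child d v : T := head v (d v).

Definition spine d v k : seq T := traject (first_child d) v k.

Definition spine_tail d v k : seq T :=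
  traject (first_child d) (first_child d v) k.

(* A childless vertex is its own [first_child], so a spine that is not proper
   ends with repetitions of its lowest vertex. *)
Definition proper_spine d v k : bool :=
  all (fun u => ~~ nilp (d u)) (spine d v k).

(* Meant for [p] a permutation of [spine_tail d v k], so that [size p = k]. *)
Definition flatten_spine d v p u : seq T :=
  (if u == v then p else [::]) ++
  (if u \in spine d v (size p) then behead (d u) else d u).

Lemma first_child_cons d u :
  ~~ nilp (d u) -> d u = first_child d u :: behead (d u).
Proof. by rewrite /first_child; case: (d u). Qed.

Lemma lt_first_child d u :
  increasing d -> ~~ nilp (d u) -> (u < first_child d u)%O.
Proof. by move=> inc /first_child_cons du; apply: inc; rewrite du mem_head. Qed.

Lemma map_first_child_spine d v k :
  map (first_child d) (spine d v k) = spine_tail d v k.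
Proof. by rewrite /spine /spine_tail; elim: k v => //= k IH v; rewrite IH. Qed.

Lemma spine_take d v k : spine d v k = take k (v :: spine_tail d v k).
Proof. by rewrite -trajectS take_traject. Qed.

Lemma lt_path_spine_tail d v k : increasing d -> proper_spine d v k ->
  path <%O v (spine_tail d v k).
Proof.
rewrite /proper_spine /spine /spine_tail => inc.
by elim: k v => //= k IH v /andP[dv proper]; rewrite lt_first_child // IH.
Qed.

Lemma flatten_spine_increasing d v p k : increasing d -> proper_spine d v k ->
  perm_eq p (spine_tail d v k) -> increasing (flatten_spine d v p).
Proof.
move=> inc proper perm_p u w; rewrite mem_cat => /orP[|].
  case: eqP => // ->; rewrite (perm_mem perm_p).
  have := lt_path_spine_tail inc proper.
  by rewrite lt_path_sortedE => /andP[/allP v_lt _] /v_lt.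
by case: ifP => _ w_in; apply: inc => //; exact: mem_behead.
Qed.

Lemma indegree_flatten_spine d v p k : increasing d -> proper_spine d v k ->
  perm_eq p (spine_tail d v k) -> indegree (flatten_spine d v p) =1 indegree d.
Proof.
move=> inc proper perm_p w.
have size_p : size p = k by rewrite (perm_size perm_p) size_traject.
have uniq_spine : uniq (spine d v k).
  rewrite spine_take take_uniq // lt_sorted_uniq //=.
  exact: lt_path_spine_tail.
have count_p : count_mem w p =
    \sum_(u : T) ((u \in spine d v k) && (first_child d u == w)).
  rewrite (seq.permP perm_p) -map_first_child_spine count_map -sum1_count.
  rewrite big_mkcond big_uniq // big_mkcond.
  by apply: eq_bigr => u _ /=; case: (u \in _); case: eqP.
rewrite /indegree; under eq_bigr do rewrite count_cat.
rewrite big_split /= (bigD1 v) //= eqxx big1 ?addn0 => [|u /negbTE->//].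
rewrite count_p -big_split size_p; apply: eq_bigr => u _ /=.
by case: ifP => // u_spine; rewrite [in RHS]first_child_cons // (allP proper).
Qed.

Lemma flatten_spine_inj d1 d2 v p1 p2 k : increasing d1 -> increasing d2 ->
  proper_spine d1 v k -> proper_spine d2 v k ->
  perm_eq p1 (spine_tail d1 v k) -> perm_eq p2 (spine_tail d2 v k) ->
  flatten_spine d1 v p1 =1 flatten_spine d2 v p2 -> d1 =1 d2 /\ p1 = p2.
Proof.
move=> inc1 inc2 proper1 proper2 perm_p1 perm_p2 eq_flat.
have size_p1 : size p1 = k by rewrite (perm_size perm_p1) size_traject.
have size_p2 : size p2 = k by rewrite (perm_size perm_p2) size_traject.
have eq_p : p1 = p2.
  have := congr1 (take k) (eq_flat v); rewrite /flatten_spine eqxx.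
  by rewrite !take_size_cat.
have eq_tail : spine_tail d1 v k = spine_tail d2 v k.
  apply: lt_sorted_eq; try exact: path_sorted (lt_path_spine_tail _ _).
  by move=> u; rewrite -(perm_mem perm_p1) eq_p (perm_mem perm_p2).
have eq_spine : spine d1 v k = spine d2 v k by rewrite !spine_take eq_tail.
have eq_first_child : {in spine d1 v k, first_child d1 =1 first_child d2}.
  apply/eq_in_map; rewrite map_first_child_spine eq_tail eq_spine.
  by rewrite map_first_child_spine.
split=> // u; have /eqP := eq_flat u.
rewrite /flatten_spine size_p1 size_p2 eq_p eqseq_cat // eqxx /= -eq_spine.
move=> /eqP; case: ifP => // u_spine eq_behead.
rewrite first_child_cons; last exact: (allP proper1).
rewrite eq_first_child // eq_behead -first_child_cons //.
by apply: (allP proper2); rewrite -eq_spine.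
Qed.

End Spine.

Section PlaneIncreasingTrees.
Local Open Scope nat_scope.
Variable n : nat.
Implicit Types (t : pitree n) (u v w : 'I_n).

Definition plane_increasing (d : 'I_n -> seq 'I_n) : Prop :=
  increasing d /\ forall w, indegree d w = (val w != 0).

Lemma children_plane_increasing t : plane_increasing (children t).
Proof.
case: t => c pc; have /andP[/forallP inc /forallP deg] := pc.
rewrite /children /=; split=> [v w|w]; last by apply/eqP; exact: deg.
by rewrite ltEord; move: (inc v) => /allP; apply.
Qed.

Lemma plane_increasing_pitree (d : 'I_n -> seq 'I_n) : plane_increasing d ->
  exists t, children t =1 d.
Proof.
move=> [inc deg].
have size_d v : size (d v) <= n.
  have uniq_d : uniq (d v).
    apply: count_mem_uniq => w.
    move: (deg w); rewrite /indegree (bigD1 v) //= -has_pred1 has_count.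
    by case: (count_mem w (d v)) => [|[|m]] //; case: (val w != 0).
  by rewrite -[leqRHS]card_ord -(card_uniqP uniq_d) max_card.
have dE v : [ffun v => insub_bseq n (d v)] v = d v :> seq _.
  rewrite ffunE /insub_bseq /insubd /=; case: insubP => [x _ -> //|].
  by rewrite size_d.
have plane_d : is_plane_increasing [ffun v => insub_bseq n (d v)].
  apply/andP; split; apply/forallP => v.
    by rewrite dE; apply/allP => w /inc; rewrite ltEord.
  by under eq_bigr do rewrite dE; rewrite -deg.
by exists (Sub _ plane_d) => v; exact: dE.
Qed.

Lemma children_inj t1 t2 : children t1 =1 children t2 -> t1 = t2.
Proof. by move=> e; apply/val_inj/ffunP => v; exact/val_inj/e. Qed.

Lemma card_pitree_gt0 : 0 < #|{: pitree n}|.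
Proof.
pose star v : seq 'I_n :=
  if val v == 0 then [seq w : 'I_n <- enum 'I_n | val w != 0] else [::].
suff /plane_increasing_pitree[t _] : plane_increasing star.
  by apply/card_gt0P; exists t.
rewrite /star; split=> [v w|w].
  by case: ifP => // /eqP v0; rewrite ltEord v0 mem_filter lt0n => /andP[].
have n0 : 0 < n by exact: leq_trans (ltn_ord w).
rewrite /indegree (bigD1 (Ordinal n0)) //= big1 ?addn0 => [|v].
  rewrite count_uniq_mem ?(filter_uniq _ (enum_uniq _)) //.
  by rewrite mem_filter mem_enum andbT.
by rewrite -val_eqE /= => /negbTE->.
Qed.

Lemma rank_le_n t v : rank t v <= n.
Proof.
by rewrite /rank; elim/big_rec: _ => // p m _ mn; rewrite geq_min mn orbT.
Qed.

Lemma rank_le_path t v (p : seq 'I_n) :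
  path (child t) v p -> leaf t (last v p) -> rank t v <= size p.
Proof.
move=> path_p leaf_p.
have [size_p|/ltnW] := leqP (size p) n; last exact/leq_trans/rank_le_n.
have := @bigmin_le_cond _ nat _ n (Bseq size_p)
  (fun p : n.-bseq 'I_n => path (child t) v p && leaf t (last v p)) size.
by rewrite path_p leaf_p leEnat minEnat; exact.
Qed.

Lemma rank_le_childS t v w : child t v w -> rank t v <= (rank t w).+1.
Proof.
move=> vw; suff : (rank t v).-1 <= rank t w by case: (rank t v).
rewrite [leqRHS]/rank; elim/big_ind: _ => [|x y lex ley|p /andP[path_p leaf_p]].
- exact: leq_trans (leq_pred _) (rank_le_n t v).
- by rewrite leq_min lex.
- rewrite -subn1 leq_subLR.
  by apply: (@rank_le_path t v (w :: p)); rewrite //= vw.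
Qed.

Lemma rank_proper_spine t v k :
  k <= rank t v -> proper_spine (children t) v k.
Proof.
rewrite /proper_spine /spine; elim: k v => //= k IH v k_rank.
have nleaf : ~~ leaf t v.
  apply/negP => leaf_v; move: k_rank.
  by rewrite ltnNge (leq_trans (@rank_le_path t v [::] _ leaf_v)).
rewrite nleaf IH // -ltnS (leq_trans k_rank) // rank_le_childS //.
by rewrite /child (first_child_cons nleaf) mem_head.
Qed.

Lemma ex_flatten_spine_children t v p k : proper_spine (children t) v k ->
  perm_eq p (spine_tail (children t) v k) ->
  exists t', children t' =1 flatten_spine (children t) v p.
Proof.
have [inc deg] := children_plane_increasing t => proper perm_p.
apply: plane_increasing_pitree; split=> [|w].
  exact: flatten_spine_increasing perm_p.
by rewrite (indegree_flatten_spine _ proper).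
Qed.

Lemma flatten_spine_children_inj t1 t2 v p1 p2 k :
  proper_spine (children t1) v k -> proper_spine (children t2) v k ->
  perm_eq p1 (spine_tail (children t1) v k) ->
  perm_eq p2 (spine_tail (children t2) v k) ->
  flatten_spine (children t1) v p1 =1 flatten_spine (children t2) v p2 ->
  t1 = t2 /\ p1 = p2.
Proof.
have [[inc1 _] [inc2 _]] :=
  (children_plane_increasing t1, children_plane_increasing t2).
move=> proper1 proper2 perm_p1 perm_p2.
by move=> /(flatten_spine_inj inc1 inc2 proper1 proper2)[] // /children_inj.
Qed.

Lemma card_proper_spine_le v k :
  #|[pred t : pitree n | proper_spine (children t) v k]| * k`! <=
    #|{: pitree n}|.
Proof.
set A := [pred t | _].
pose tail t := spine_tail (children t) v k.
pose flat t p := finfun (flatten_spine (children t) v p).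
have uniq_tail t : t \in A -> uniq (tail t).
  move=> tA; apply/lt_sorted_uniq/path_sorted/lt_path_spine_tail => //.
  exact: (children_plane_increasing t).1.
have -> : #|A| * k`! =
    size [seq flat t p | t <- enum A, p <- permutations (tail t)].
  rewrite size_allpairs_dep sumnE big_map big_enum -sum_nat_const.
  by apply: eq_bigr => t /uniq_tail/size_permutations->; rewrite size_traject.
have -> : #|{: pitree n}| = size [seq finfun (children t) | t : pitree n].
  by rewrite size_map -cardE.
apply: uniq_leq_size => [|_ /allpairsPdep[t [p [tA perm_p ->]]]].
  apply: allpairs_uniq_dep => [|t _|]; rewrite ?enum_uniq ?permutations_uniq //.
  move=> _ _ /allpairsPdep[t1 [p1 [tA1 perm_p1 ->]]]
    /allpairsPdep[t2 [p2 [tA2 perm_p2 ->]]] /= /ffunP eq_flat.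
  rewrite !mem_enum in tA1 tA2; rewrite !mem_permutations in perm_p1 perm_p2.
  have [|-> -> //] := flatten_spine_children_inj tA1 tA2 perm_p1 perm_p2.
  by move=> u; have := eq_flat u; rewrite !ffunE.
rewrite mem_enum in tA; rewrite mem_permutations in perm_p.
have [t' children_t'] := ex_flatten_spine_children tA perm_p.
apply/mapP; exists t'; rewrite ?mem_enum //.
by apply/ffunP => u; rewrite !ffunE children_t'.
Qed.

Lemma X_ge_gt0 t k : (0 < X_ge k.+1 t) = (k < max_rank t).
Proof.
rewrite lt0n ltnNge; congr (~~ _); apply/eqP/bigmax_leqP => [X0 v _|rank_le_k].
  by have := card0_eq X0 v; rewrite !inE ltnNge => /negbFE.
by apply: eq_card0 => v; rewrite !inE ltnNge rank_le_k.
Qed.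

End PlaneIncreasingTrees.

Section Uniform.
Variables (R : realType) (T : finType).
Implicit Types (A B : pred T) (X : T -> R).

Lemma unif_probC A : (0 < #|T|)%N ->
  1 - unif_prob R A = unif_prob R (predC A).
Proof.
move=> T0; rewrite /unif_prob -[in RHS](addKn #|A| #|[predC A]|) cardC.
by rewrite natrB ?max_card // mulrBl divff // pnatr_eq0 -lt0n.
Qed.

Lemma unif_prob_ge0 A : 0 <= unif_prob R A.
Proof. exact: divr_ge0. Qed.

Lemma le_unif_prob A B : subpred A B -> unif_prob R A <= unif_prob R B.
Proof.
move=> AB; rewrite ler_wpM2r // ler_nat subset_leq_card //.
exact/fintype.subsetP.
Qed.

Lemma unif_markov X (a : R) : (forall t, 0 <= X t) ->
  a * unif_prob R [pred t | a <= X t] <= unif_expect X.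
Proof.
move=> X0; rewrite /unif_prob /unif_expect mulrA ler_wpM2r //.
rewrite mulr_natr -sumr_const big_mkcond ler_sum // => t _.
by rewrite inE; case: ifP.
Qed.

Lemma unif_expect_card (I : finType) (P : I -> pred T) :
  unif_expect (fun t => #|[pred i | P i t]|%:R) = \sum_i unif_prob R (P i).
Proof.
rewrite /unif_expect /unif_prob -mulr_suml -!natr_sum; congr (_%:R / _).
under eq_bigr do rewrite -sum1_card big_mkcond.
rewrite exchange_big; apply: eq_bigr => i _.
by rewrite -sum1_card [RHS]big_mkcond.
Qed.

End Uniform.

Section RankTail.
Variables (R : realType) (n : nat).

Lemma prob_rank_ge_le (v : 'I_n) k :
  unif_prob R (fun t : pitree n => (k <= rank t v)%N) <= k`!%:R^-1.
Proof.
apply: (@le_trans _ _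
    (unif_prob R (fun t : pitree n => proper_spine (children t) v k))).
  by apply: le_unif_prob => t; exact: rank_proper_spine.
rewrite ler_pdivrMr ?ltr0n ?card_pitree_gt0 // ler_pdivlMl ?ltr0n ?fact_gt0 //.
by rewrite -natrM ler_nat mulnC card_proper_spine_le.
Qed.

Lemma expect_X_ge_le k :
  unif_expect (fun t : pitree n => (X_ge k t)%:R) <= n%:R / k`!%:R :> R.
Proof.
rewrite unif_expect_card mulr_natl -[n in _ *+ n]card_ord -sumr_const.
by apply: ler_sum => v _; exact: prob_rank_ge_le.
Qed.

Lemma prob_max_rank_gt_le (x : R) : 0 <= x ->
  unif_prob R (fun t : pitree n => x < (max_rank t)%:R)
    <= n%:R / (Num.truncn x).+1`!%:R.
Proof.
move=> x0; apply: le_trans (expect_X_ge_le _).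
apply: le_trans (unif_markov 1 _) => //.
rewrite mul1r; apply: le_unif_prob => t /=.
by rewrite ler1n X_ge_gt0 truncn_lt_nat.
Qed.

End RankTail.

Section Asymptotics.
Variable R : realType.
Implicit Types a b c x y z : R.

Lemma exprn_le_fact_expR x k : 0 <= x -> x ^+ k <= k`!%:R * expR x.
Proof.
case: k => [|k] x0; first by rewrite fact0 expr0 mul1r -expR0 ler_expR.
rewrite -ler_pdivrMl ?ltr0n ?fact_gt0 // mulrC.
by apply: le_trans (expR_ge1Dxn k x0); rewrite lerDr.
Qed.

Lemma expR_le_fact_truncnS x :
  1 <= x -> expR (x * (ln x - 1)) <= (Num.truncn x).+1`!%:R.
Proof.
move=> x1; have x0 : 0 < x by rewrite (lt_le_trans ltr01).
rewrite mulrBr mulr1 expRD expRN ler_pdivrMr ?expR_gt0 //.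
apply: le_trans (exprn_le_fact_expR _ (ltW x0)).
rewrite -powR_mulrn ?(ltW x0) // /powR gt_eqF // ler_expR ler_wpM2r ?ln_ge0 //.
exact/ltW/truncnS_gt.
Qed.

Lemma ln_le_tangent a y : 0 < a -> 0 < y -> ln y <= ln a + (y / a - 1).
Proof.
move=> a0 y0; have -> : ln y = ln a + ln (y / a).
  by rewrite -lnM ?posrE ?divr_gt0 // mulrC divfK ?gt_eqF.
by rewrite lerD2l -[X in ln X](subrKC 1) le_ln1Dx // ltrBrDl subrr divr_gt0.
Qed.

Lemma near_lnD_le_linear a b : 0 < a -> \forall y \near +oo, ln y + b <= a * y.
Proof.
move=> a0; near=> y.
have y0 : 0 < y by [].
have a20 : 0 < 2 / a by rewrite divr_gt0.
have := ln_le_tangent a20 y0; rewrite invf_div.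
have : (ln (2 / a) - 1 + b) / (a / 2) <= y by [].
rewrite ler_pdivrMr ?divr_gt0 //; lra.
Unshelve. all: by end_near. Qed.

Lemma cvgr_ln : @ln R x @[x --> +oo] --> +oo.
Proof.
apply/cvgryPgt => A; near=> x.
have Ax : expR A < x by [].
by rewrite -[ltLHS]expRK ltr_ln ?posrE ?expR_gt0 // (lt_trans _ Ax) ?expR_gt0.
Unshelve. all: by end_near. Qed.

Lemma near_linear_le_mul_ln a c : 0 < a -> c < a ->
  \forall z \near +oo,
    let x := a * (z / ln z) in 0 < x /\ c * z <= x * (ln x - 1).
Proof.
move=> a0 ca; have d0 : 0 < 1 - c / a by rewrite subr_gt0 ltr_pdivrMr ?mul1r.
near=> z; set x := a * (z / ln z).
have z0 : 0 < z by [].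
have y0 : 0 < ln z by near: z; move: cvgr_ln => /cvgryPgt; exact.
have x0 : 0 < x by rewrite mulr_gt0 ?divr_gt0.
split=> //.
have lnx : ln x = ln a + ln z - ln (ln z).
  by rewrite lnM ?ln_div ?posrE ?divr_gt0 // addrA.
have : ln (ln z) + (1 - ln a) <= (1 - c / a) * ln z.
  by near: z; exact: cvgr_ln (near_lnD_le_linear _ d0).
rewrite mulrBl mul1r => lnlnz.
have -> : c * z = x * (c / a * ln z).
  by rewrite /x; field; rewrite !gt_eqF.
rewrite ler_pM2l // lnx; lra.
Unshelve. all: by end_near. Qed.

Lemma near_expR_le_fact a c : 0 < c -> c < a ->
  \forall z \near +oo, let x := a * (z / ln z) in
    0 <= x /\ expR (c * z) <= (Num.truncn x).+1`!%:R.
Proof.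
move=> c0 ca; have near_x := near_linear_le_mul_ln (lt_trans c0 ca) ca.
apply: filterS2 (nbhs_pinfty_gt (num_real 0)) near_x => z z0.
set x := a * (z / ln z) => -[x0 czx]; split; first exact: ltW.
have x1 : 1 <= x.
  have lnx1 : 0 < ln x - 1.
    by rewrite -(pmulr_rgt0 _ x0) (lt_le_trans _ czx) ?mulr_gt0.
  by rewrite leNgt; apply/negP => /ltW/ln_le0; lra.
by apply: le_trans (expR_le_fact_truncnS x1); rewrite ler_expR.
Qed.

Lemma near_powR_le_fact a c : 0 < c -> c < a ->
  \forall n \near \oo, let x := a * (ln n%:R / ln (ln n%:R)) in
    0 <= x /\ n%:R `^ c <= (Num.truncn x).+1`!%:R.
Proof.
move=> c0 ca; have lnn : @ln R n%:R @[n --> \oo] --> +oo.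
  exact: cvg_comp cvgr_idn cvgr_ln.
apply: filterS2 (nbhs_infty_gtr (0 : R)) (lnn _ (near_expR_le_fact c0 ca)).
by move=> n n0; rewrite /= /powR gt_eqF.
Qed.

End Asymptotics.

Theorem theorem3p3 (R : realType) :
  (exists C : R, forall n k : nat, (2 <= k <= n)%N ->
     unif_expect (fun t : pitree n => (X_ge k t)%:R)
       <= C * (n%:R `^ (3 / 2) / ((k - 2)`!)%:R)) /\
  (forall eps : R, 0 < eps ->
     exists2 delta : nat -> R, delta @ \oo --> (0 : R) &
       (fun n : nat => 1 - unif_prob R (fun t : pitree n =>
          (max_rank t)%:R <= (3 / 2 + eps) * (ln n%:R / ln (ln n%:R)) :> R))
       =O_\oo (fun n : nat => n%:R `^ (- eps + delta n))).
Proof.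
split.
  exists 1 => n k /andP[k2 kn]; rewrite mul1r.
  have n1 : (1 : R) <= n%:R by rewrite ler1n (leq_trans _ kn) // ltnW.
  apply: le_trans (expect_X_ge_le R n k) _; rewrite ler_pM ?invr_ge0 //.
    by rewrite -[leLHS]powRr1 // ler_powR //; lra.
  by rewrite lef_pV2 ?posrE ?ltr0n ?fact_gt0 // ler_nat leq_fact // leq_subr.
move=> eps eps0; exists (fun=> 0); first exact: cvg_cst.
have [c0 ca] : 0 < 1 + eps /\ 1 + eps < 3 / 2 + eps by split; lra.
apply/eqO_exP; exists 1 => //.
apply: filterS2 (nbhs_infty_gtr (0 : R)) (near_powR_le_fact c0 ca) => n n0.
set x := _ * (ln n%:R / _) => -[x0 fact_ge].
rewrite unif_probC ?card_pitree_gt0 // ger0_norm ?unif_prob_ge0 //.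
rewrite mul1r addr0 ger0_norm ?powR_ge0 //.
apply: (@le_trans _ _ (n%:R / (Num.truncn x).+1`!%:R)).
  apply: le_trans (prob_max_rank_gt_le n x0).
  by apply: le_unif_prob => t /=; rewrite -ltNge.
rewrite ler_pdivrMr ?ltr0n ?fact_gt0 //.
have {1}-> : (n%:R : R) = n%:R `^ (- eps) * n%:R `^ (1 + eps).
  by rewrite -powRD ?(gt_eqF n0) ?implybT // addrCA addNr addr0 powRr1 // ltW.
by rewrite ler_pM2l ?powR_gt0.
Qed.
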